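(* Let $n,t$ be positive integers with $t\ge 2$ and $n\ge \max\{t^3+4t^2+3t+4,\ \tfrac{17}{2}t^2+30t+27\}$. Let $g(n,t)=\left\lceil\frac{n+t}{2}\right\rceil \left\lfloor\frac{n-t}{2}\right\rfloor+tn+1$. (i) If $\lfloor (n-t)/2\rfloor$ is odd, then $ex(n,P_{t+1,2})=g(n,t)$. (ii) If $\lfloor (n-t)/2\rfloor$ is even, then $ex(n,P_{t+1,2})\in\{g(n,t)-1,\,g(n,t)\}$.
   Context: All digraphs are strict: no loops and no two parallel arcs (two arcs between the same pair of vertices in the same direction); arcs $uv$ and $vu$ may both be present. For a positive integer $k$, $P_{k,2}$ denotes the digraph consisting of $k$ directed paths of length 2 with the same initial vertex and the same terminal vertex (and otherwise disjoint), i.e. vertices $u,w,x_1,\dots,x_k$ (all distinct) with arcs $ux_i$ and $x_iw$ for $i=1,\dots,k$. A digraph is $P_{k,2}$-free if it contains no subdigraph isomorphic to $P_{k,2}$, i.e. there are no distinct vertices $u\neq w$ with $k$ distinct vertices $x$ (different from $u,w$) such that $ux$ and $xw$ are arcs. $ex(n,P_{k,2})$ is the maximum number of arcs of a $P_{k,2}$-free digraph on $n$ vertices. *)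

(* Defs.v *)
From mathcomp Require Import all_boot all_order.
Set Implicit Arguments. Unset Strict Implicit. Unset Printing Implicit Defensive.

(* A strict digraph on the vertex set 'I_n is represented by its arc set
   A : {set 'I_n * 'I_n}; (u, v) \in A means the arc uv is present.
   Sets exclude parallel arcs automatically; loops are excluded by [loopless]. *)
Definition loopless (n : nat) (A : {set 'I_n * 'I_n}) : bool :=
  [forall v : 'I_n, (v, v) \notin A].

Definition contains_Pk2 (k n : nat) (A : {set 'I_n * 'I_n}) : bool :=
  [exists u : 'I_n, exists w : 'I_n,
     (u != w) &&
     (k <= #|[set x : 'I_n | [&& x != u, x != w, (u, x) \in A & (x, w) \in A]]|)].

Definition Pk2_free (k n : nat) (A : {set 'I_n * 'I_n}) : bool :=
  ~~ contains_Pk2 k A.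

Definition ex_Pk2 (n k : nat) : nat :=
  \max_(A : {set 'I_n * 'I_n} | loopless A && Pk2_free k A) #|A|.

(* g(n,t) = ceil((n+t)/2) * floor((n-t)/2) + t n + 1  (used with n >= t). *)
Definition g_nt (n t : nat) : nat :=
  (n + t).+1./2 * (n - t)./2 + t * n + 1.

(* Main.v *)
(* Upper bound. Let u be a vertex of maximum out-degree D, A its out-neighbourhood,
   B the complement of A, and suppose that there are more than g(n,t) arcs.
   Counting the arcs leaving A as the ends of 2-paths from u, at most t per vertex
   other than u, shows that D is close to n/2, that almost every vertex of B has
   out-degree D, that almost every vertex receives t arcs from A, and then that
   every vertex sends at most t arcs to B. Hence the vertices of A missed by the
   full-degree vertices of B lie in a set Z of fewer than 3t vertices of large
   out-degree.
   - If all in- and out-degrees are below (n+t)/2, almost every vertex of A is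
     missed by some vertex of B, which Z is too small to allow.
   - Otherwise, up to reversal, D >= (n+t)/2, and the count forces every vertex of
     out-degree D to be in at least t+2 2-cycles, hence almost every vertex of B to
     be in two 2-cycles inside B. Then almost every vertex of B is an
     out-neighbour of Z, although Z sends few arcs to B.

   Lower bound. Take a complete bipartite orientation V1 -> V2 and add arcs inside
   V1 and from V2 to V1. One more arc is gained when V1 and V2 can be mostly
   covered by 2-cycles, which needs floor((n-t)/2) odd. *)

Require Import Defs.
From mathcomp Require Import all_boot all_order all_algebra.
From mathcomp Require Import zify.
Set Implicit Arguments. Unset Strict Implicit. Unset Printing Implicit Defensive.

(** * Digraphs as relations, and double counting of arcs *)

Definition out (V : finType) (e : rel V) (x : V) : {set V} := [set y | e x y].
(** Being [out] of the reversed relation, it lets statements on out-degrees transfer to in-degrees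
    by conversion. *)
Definition inn (V : finType) (e : rel V) : V -> {set V} :=
  out (fun x y => e y x).
Definition size_rel (V : finType) (e : rel V) : nat := \sum_x #|out e x|.
(** For irreflexive [e] the midpoints automatically differ from [u] and [w], so this is freeness
    from [t.+1] such paths. *)
Definition few_2paths (t : nat) (V : finType) (e : rel V) : Prop :=
  forall u w, u != w -> #|out e u :&: inn e w| <= t.

Lemma card_setI_sum (T : finType) (X Y : {set T}) :
  #|X :&: Y| = \sum_(y in Y) (y \in X).
Proof.
rewrite -sum1_card big_mkcond [RHS]big_mkcond /=; apply: eq_bigr => y _.
by rewrite inE; case: (y \in X); case: (y \in Y).
Qed.

Lemma sum_out_inn (V : finType) (e : rel V) (X Y : {set V}) :
  \sum_(x in X) #|out e x :&: Y| = \sum_(y in Y) #|X :&: inn e y|.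
Proof.
under eq_bigr do rewrite card_setI_sum.
rewrite exchange_big /=; apply: eq_bigr => y _.
rewrite setIC card_setI_sum; apply: eq_bigr => x _.
by rewrite !inE.
Qed.

Lemma size_rel_inn (V : finType) (e : rel V) : size_rel e = \sum_x #|inn e x|.
Proof.
have := sum_out_inn e setT setT.
under eq_bigr do rewrite setIT.
under [in RHS]eq_bigr do rewrite setTI.
rewrite /size_rel => H.
by under eq_bigl => x do rewrite -(in_setT x); rewrite H; apply: eq_bigl => x; rewrite in_setT.
Qed.

Lemma leq_card_bigcup (I T : finType) (P : pred I) (F : I -> {set T}) :
  #|\bigcup_(i | P i) F i| <= \sum_(i | P i) #|F i|.
Proof.
elim/big_rec2: _ => [|i m X _ IH]; first by rewrite cards0.
by apply: leq_trans (leq_card_setU _ _) _; rewrite leq_add2l.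
Qed.

(* The numerical side of [MaxOut] below: [n] vertices, [D] the maximum
   out-degree, attained at [u], [m = n - D], [r] the number of 2-cycles through
   [u], [s] the slack, [E] the number of arcs. *)
Section DegreeArithmetic.
Variables n t D m r s E : nat.
Hypothesis t_ge2 : 2 <= t.
Hypothesis nDm : m + D = n.
Hypothesis quad_n : 17 * t ^ 2 + 60 * t + 54 <= 2 * n.
Hypothesis E_slack : E + s + t = t * n + r + D * m.
Hypothesis E_big : n ^ 2 + 4 * t * n + 8 <= 4 * E + t.+1 ^ 2.

(** With [x] the distance between [D] and [m], [4 * D * m = n ^ 2 - x ^ 2]; a large [E] thus bounds
    both the imbalance [x] and the slack in terms of [r]. *)
Lemma gap_square : exists2 x, m = D + x \/ D = m + x
  & 4 * s + x * x + 2 * t + 7 <= 4 * r + t ^ 2.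
Proof.
move: E_big E_slack; rewrite -nDm -!mulnn => HE Hs.
case: (leqP D m) => [Dm|/ltnW Dm].
- exists (m - D); first by left; lia.
  move: HE Hs; have -> : m = D + (m - D) by lia.
  move: (m - D) => x; rewrite addKn; lia.
exists (D - m); first by right; lia.
move: HE Hs; have -> : D = m + (D - m) by lia.
move: (D - m) => x; rewrite addKn; lia.
Qed.

Lemma n_ge121 : 121 <= n.
Proof. by have := leq_mul t_ge2 t_ge2; rewrite mulnn; lia. Qed.

Lemma max_out_rough : r <= D -> 2 * n <= 5 * D /\ 5 * D <= 3 * n.
Proof.
move=> rD; have [x mD H] := gap_square.
suff : 5 * x <= n by lia.
rewrite leqNgt; apply/negP=> X.
have X2 : n * n <= (5 * x) * (5 * x) by apply: leq_mul; lia.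
have Y : 121 * n <= n * n by rewrite leq_mul2r n_ge121 orbT.
lia.
Qed.

(** As [D >= 2n/5], the term [t * n] accounts for at most [5t/2] of [k]; [D] and [s] add at most
    about 1 each. *)
Lemma OB_count_rough k : 2 * n <= 5 * D -> r <= D ->
  k * D + t <= t * n + D + s -> 2 * k <= 5 * t + 4.
Proof.
move=> H1 H2 H3; have [x _ H] := gap_square.
rewrite leqNgt; apply/negP=> X.
have [k' kE] : exists k', k = k'.+2 by exists (k - 2); lia.
subst k; have : (5 * t + 1) * (2 * n) <= (2 * k') * (5 * D) by apply: leq_mul; lia.
lia.
Qed.

(** Each unit of [r] beyond [t + K] costs [m - 1] units of slack, more than [gap_square] allows. *)
Lemma recip_count_le K : 2 * K <= 5 * t + 4 -> 5 * D <= 3 * n ->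
  (m - 1) * (r - t) <= (m - 1) * K + s -> r <= t + K.
Proof.
move=> H1 H2 H3; have [x _ H] := gap_square.
rewrite leqNgt; apply/negP=> X.
have [j rE] : exists j, r = t + K + j.+1 by exists (r - (t + K)).-1; lia.
rewrite rE in H H3.
have jE : t + K + j.+1 - t = K + j.+1 by lia.
have H4 : (m - 1) * j.+1 <= s by rewrite jE in H3; lia.
have : (m - 2) * 1 <= (m - 2) * j.+1 by rewrite leq_mul2l orbT.
have := n_ge121.
have mE : m - 1 = (m - 2).+1 by lia.
rewrite mE in H4.
lia.
Qed.

Lemma missed_count_small K : 2 * K <= 5 * t + 4 -> r <= t + K -> 2 * n <= 5 * D ->
  t.+1 * K + s < D - 1.
Proof.
move=> H1 H2 H3; have [x _ H] := gap_square.
have : t.+1 * (2 * K) <= t.+1 * (5 * t + 4) by apply: leq_mul.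
move: quad_n; rewrite -!mulnn in H *; lia.
Qed.

Lemma max_out_near_half : r <= 2 * t -> n <= 2 * D + t + 2 /\ 2 * D <= n + t + 2.
Proof.
move=> H1; have [x mD H] := gap_square.
suff : x < t + 3 by lia.
rewrite ltnNge; apply/negP=> X.
have := leq_mul X X; lia.
Qed.

Lemma high_count_lt z : r <= 2 * t ->
  z * (D - (t * t + s)) + t <= t * n + r -> z < 3 * t.
Proof.
move=> H1 H2; have [x _ H] := gap_square; have [H3 _] := max_out_near_half H1.
rewrite ltnNge; apply/negP=> X.
have : 3 * t * (2 * n) <= 3 * t * (4 * (D - (t * t + s)) + 5 * t ^ 2 + 8 * t).
  by rewrite leq_mul2l; apply/orP; right; rewrite -!mulnn in H *; lia.
have := leq_mul X (leqnn (D - (t * t + s))).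
have : t * (17 * t ^ 2 + 60 * t + 54) <= t * (2 * n) by rewrite leq_mul2l quad_n orbT.
lia.
Qed.

End DegreeArithmetic.

(** * Structure around a vertex of maximum out-degree *)

Section MaxOut.
Variables (V : finType) (e : rel V) (t : nat) (u : V).
Hypothesis e_irr : irreflexive e.
Hypothesis e_few : few_2paths t e.
Hypothesis u_max : forall x, #|out e x| <= #|out e u|.

Local Notation n := #|V|.
Local Notation D := #|out e u|.
Local Notation A := (out e u).
Local Notation B := (~: A).
(** [r] counts the 2-cycles through [u], and [p w] the 2-paths from [u] to [w]. *)
Local Notation r := #|A :&: inn e u|.
Local Notation p w := #|A :&: inn e w|.
Local Notation def x := (D - #|out e x|).
Local Notation M y := (A :\: out e y).
Local Notation OB y := (out e y :\: A).

(* What is lost when bounding the number of arcs by [t (n-1) + r + D (n-D)], the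
   arcs leaving [A] being counted as ends of 2-paths from [u]. *)
Definition slack : nat := \sum_(w | w != u) (t - p w) + \sum_(y in B) def y.

Lemma card_B : #|B| + D = n.
Proof. by rewrite addnC cardsC. Qed.

Lemma p_le w : w != u -> p w <= t.
Proof. by move=> wu; apply: e_few; rewrite eq_sym. Qed.

Lemma out_def x : #|out e x| + def x = D.
Proof. by rewrite subnKC. Qed.

Lemma card_M y : #|M y| = #|OB y| + def y.
Proof.
have := cardsID (out e y) A; have := cardsID A (out e y).
have := out_def y; rewrite setIC; lia.
Qed.

Lemma size_slack : size_rel e + slack + t = t * n + r + D * (n - D).
Proof.
have HA : \sum_(x in A) #|out e x| = r + \sum_(w | w != u) p w.
  have := sum_out_inn e A setT; under eq_bigr do rewrite setIT.
  move=> ->; rewrite (bigD1 u) ?inE //=; congr (_ + _).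
  by apply: eq_bigl => w; rewrite inE.
have Hp : \sum_(w | w != u) p w + \sum_(w | w != u) (t - p w) + t = t * n.
  rewrite -big_split /=.
  rewrite (eq_bigr (fun=> t)); last by move=> w wu; rewrite subnKC // p_le.
  rewrite sum_nat_const (cardC1 u) mulnC.
  have : 0 < n by apply/card_gt0P; exists u.
  by case: #|V| => // m _ /=; rewrite mulnS addnC.
have HB : \sum_(x in B) #|out e x| + \sum_(x in B) def x = D * (n - D).
  rewrite -big_split /= (eq_bigr (fun=> D)); last by move=> w _; rewrite out_def.
  by rewrite sum_nat_const mulnC -card_B addnK.
have HT : size_rel e = \sum_(x in A) #|out e x| + \sum_(x in B) #|out e x|.
  rewrite /size_rel (bigID (mem A)) /=; congr (_ + _).
  by apply: eq_bigl => x; rewrite in_setC.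
rewrite HT HA /slack; move: Hp HB.
by move: (\sum_(w | _) _) (\sum_(w | _) (_ - _)) (\sum_(y in B) _) (\sum_(y in B) _); lia.
Qed.

Lemma sum_def_le (X : {set V}) : X \subset B -> \sum_(x in X) def x <= slack.
Proof.
move=> /subsetP XB; apply: leq_trans (leq_addl _ _).
rewrite [leqLHS]big_mkcond [leqRHS]big_mkcond /=; apply: leq_sum => x _.
by case: ifP => // /XB ->.
Qed.

(** Of the 2-paths from [x], at most [t] end at each other vertex; those returning to [x] are its
    2-cycles. *)
Lemma sum_out_path x :
  \sum_(y in out e x) #|out e y| + t <= t * n + #|out e x :&: inn e x|.
Proof.
have := sum_out_inn e (out e x) setT; under eq_bigr do rewrite setIT.
move=> ->; rewrite (bigD1 x) ?inE //=.
have : \sum_(i in [set: V] | i != x) #|out e x :&: inn e i| <= t * n.-1.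
  rewrite -(cardC1 x) mulnC -sum_nat_const.
  rewrite (eq_bigl (fun i => i != x)); last by move=> i; rewrite inE.
  by apply: leq_sum => i ix; apply: e_few; rewrite eq_sym.
have : 0 < n by apply/card_gt0P; exists x.
case: #|V| => // m _ /=; rewrite mulnS; lia.
Qed.

Lemma OB_subB x : OB x \subset B.
Proof. by apply/subsetP=> y; rewrite !inE => /andP[]. Qed.

Lemma OB_mul x : #|OB x| * D + t <= t * n + D + slack.
Proof.
have H1 := sum_out_path x.
have H2 : \sum_(y in OB x) #|out e y| + \sum_(y in OB x) def y = #|OB x| * D.
  rewrite -big_split /= (eq_bigr (fun=> D)); last by move=> w _; rewrite out_def.
  by rewrite sum_nat_const.
have H3 : \sum_(y in OB x) #|out e y| <= \sum_(y in out e x) #|out e y|.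
  rewrite [leqRHS](bigID (mem A)) /= addnC.
  rewrite (eq_bigl (fun y => (y \in out e x) && (y \notin A))) ?leq_addr //.
  by move=> y; rewrite inE andbC.
have H4 := sum_def_le (OB_subB x).
have H5 : #|out e x :&: inn e x| <= D.
  by apply: leq_trans (u_max x); apply: subset_leq_card; apply: subsetIl.
lia.
Qed.

Lemma u_in_B : u \in B.
Proof. by rewrite !inE e_irr. Qed.

(** Among the [r] vertices in 2-cycles with [u], at most [t] are out-neighbours of a given [y] in
    [B] other than [u], as they are midpoints from [y] to [u]; the rest lie in [M y]. *)
Lemma recip_bound K : (forall y, y \in B -> #|OB y| <= K) ->
  (n - D - 1) * (r - t) <= (n - D - 1) * K + slack.
Proof.
move=> HK.
have cB : #|B :\ u| = n - D - 1.
  have := cardsD1 u B; rewrite u_in_B; have := card_B; lia.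
rewrite -cB.
have H1 : #|B :\ u| * (r - t) <= \sum_(y in B :\ u) #|M y|.
  rewrite -sum_nat_const; apply: leq_sum => y /setD1P[yu yB].
  have := e_few yu.
  have : #|A :&: inn e u| <= #|M y| + #|out e y :&: inn e u|.
    rewrite -(cardsID (out e y) (A :&: inn e u)) addnC; apply: leq_add.
      by apply: subset_leq_card; apply: setSD; apply: subsetIl.
    apply: subset_leq_card; apply/subsetP=> x; rewrite !inE; case/andP=> /andP[_ ->] -> //.
  lia.
apply: (leq_trans H1).
rewrite (eq_bigr (fun y => #|OB y| + def y)); last by move=> y _; rewrite card_M.
rewrite big_split /=; apply: leq_add.
  by rewrite -sum_nat_const; apply: leq_sum => y /setD1P[_ /HK].
by apply: sum_def_le; apply: subD1set.
Qed.

(* If [x] sent to [m] vertices of [B], each of which sees almost all of [A],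
   they would have to miss jointly every vertex of [A] other than [x]. *)
Lemma OB_le K : (forall y, y \in B -> #|OB y| <= K) ->
  t.+1 * K + slack < D - 1 -> forall x, #|OB x| <= t.
Proof.
move=> HK Hbig x; rewrite leqNgt; apply/negP=> Hx.
have [Y [YO cY]] : exists Y : {set V}, Y \subset OB x /\ #|Y| = t.+1.
  have : 0 < #|[set Y : {set V} | Y \subset OB x & #|Y| == t.+1]|.
    by rewrite cards_draws bin_gt0.
  by case/card_gt0P=> Y; rewrite inE => /andP[YO /eqP]; exists Y.
have YB := subset_trans YO (OB_subB x).
have Hsub : A :\ x \subset \bigcup_(y in Y) M y.
  apply/subsetP=> w /setD1P[wx wA].
  have : ~~ (Y \subset inn e w).
    apply/negP=> Yw.
    have : Y \subset out e x :&: inn e w.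
      by rewrite subsetI Yw (subset_trans YO) ?subsetDl.
    move=> /subset_leq_card; rewrite cY => H.
    by have := e_few (u := x) (w := w); rewrite eq_sym wx => /(_ isT); lia.
  case/subsetPn=> y yY; rewrite !inE => yw.
  by apply/bigcupP; exists y => //; rewrite !inE yw; rewrite inE in wA.
have := leq_trans (subset_leq_card Hsub) (leq_card_bigcup _ _).
have : \sum_(y in Y) #|M y| <= t.+1 * K + slack.
  rewrite (eq_bigr (fun y => #|OB y| + def y)); last by move=> y _; rewrite card_M.
  rewrite big_split /=; apply: leq_add; last exact: sum_def_le.
  rewrite -cY -sum_nat_const; apply: leq_sum => y /(subsetP YB); exact: HK.
have := cardsD1 x A; lia.
Qed.

(** Split the midpoints from [y] to [w] according to [A]; those in [A] are the ones counted by
    [p w], minus [M y]. *)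
Lemma two_paths_A y w : w != y ->
  #|OB y :&: inn e w| + p w <= #|M y :&: inn e w| + t.
Proof.
rewrite eq_sym => /e_few H.
have H1 := cardsID A (out e y :&: inn e w).
have H2 := cardsID (out e y) (A :&: inn e w).
have E1 : out e y :&: inn e w :\: A = OB y :&: inn e w by rewrite setIDAC.
have E2 : A :&: inn e w :\: out e y = M y :&: inn e w by rewrite setIDAC.
have E3 : A :&: inn e w :&: out e y = out e y :&: inn e w :&: A.
  by rewrite setIC setIA (setIC _ A) -setIA (setIC A).
rewrite E1 in H1; rewrite E2 E3 in H2; lia.
Qed.

Hypothesis t_ge2 : 2 <= t.
Hypothesis quad_n : 17 * t ^ 2 + 60 * t + 54 <= 2 * n.
Hypothesis cubic_n : t ^ 3 + 4 * t ^ 2 + 3 * t + 4 <= n.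
Hypothesis e_big : n ^ 2 + 4 * t * n + 8 <= 4 * size_rel e + t.+1 ^ 2.

Let slack_eq : size_rel e + slack + t = t * n + r + D * #|B|.
Proof. by rewrite size_slack -card_B addnK. Qed.

Let r_le_D : r <= D.
Proof. by apply: subset_leq_card; apply: subsetIl. Qed.

(** Bootstrap: counting 2-paths gives the crude bound [5t/2 + 2], which bounds [r], hence the slack,
    well enough for [OB_le]. *)
Lemma OB_le_t x : #|OB x| <= t.
Proof.
have [H1 H2] := max_out_rough t_ge2 card_B quad_n slack_eq e_big r_le_D.
have HK y : y \in B -> #|OB y| <= (5 * t + 4)./2.
  move=> _.
  have := OB_count_rough t_ge2 card_B quad_n slack_eq e_big H1 r_le_D (OB_mul y); lia.
have HK2 : 2 * (5 * t + 4)./2 <= 5 * t + 4 by lia.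
have := recip_bound HK.
rewrite -card_B addnK => Hr.
have {}Hr := recip_count_le t_ge2 card_B quad_n slack_eq e_big HK2 H2 Hr.
apply: (OB_le HK).
exact: (missed_count_small t_ge2 card_B quad_n slack_eq e_big HK2 Hr H1).
Qed.

Lemma r_le_2t : r <= 2 * t.
Proof.
have [H1 H2] := max_out_rough t_ge2 card_B quad_n slack_eq e_big r_le_D.
have := recip_bound (fun y _ => OB_le_t y).
rewrite -card_B addnK => Hr.
have := recip_count_le t_ge2 card_B quad_n slack_eq e_big _ H2 Hr; lia.
Qed.

Lemma D_near : n <= 2 * D + t + 2 /\ 2 * D <= n + t + 2.
Proof. exact: max_out_near_half t_ge2 card_B quad_n slack_eq e_big r_le_2t. Qed.

Lemma slack_quad : 4 * slack + 7 <= t ^ 2 + 6 * t.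
Proof.
have [x _] := gap_square t_ge2 card_B quad_n slack_eq e_big.
have := r_le_2t; lia.
Qed.

Definition high_in_A := [set z in A | D <= #|out e z| + (t * t + slack)].
Local Notation Z := high_in_A.

(** Sum [two_paths_A] over [A]. The [#|M y|] vertices of [OB y] send nearly [D] arcs each into [A],
    so [M y] must send nearly [#|M y| * D], with total loss at most [t * t + slack]. As no vertex
    sends more than [D], each one of [M y] is high. *)
Lemma M_high y : y \in B -> def y = 0 -> M y \subset Z.
Proof.
move=> yB dy; apply/subsetP=> z zM.
have zA : z \in A by move: zM; rewrite inE => /andP[].
suff H : D <= #|out e z| + (t * t + slack) by rewrite inE zA.
have cM : #|M y| = #|OB y| by rewrite card_M dy addn0.
have H1 : \sum_(w in A) (#|OB y :&: inn e w| + p w)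
          <= \sum_(w in A) (#|M y :&: inn e w| + t).
  apply: leq_sum => w wA; apply: two_paths_A.
  by apply: contraTneq wA => ->; rewrite -in_setC.
have H2 : \sum_(w in A) t <= \sum_(w in A) p w + \sum_(w in A) (t - p w).
  by rewrite -big_split /=; apply: leq_sum => w _; lia.
have H3 : \sum_(w in A) (t - p w) + \sum_(y' in OB y) def y' <= slack.
  apply: leq_add.
    rewrite [leqLHS]big_mkcond [leqRHS]big_mkcond /=; apply: leq_sum => x _.
    case: ifP => // xA; case: ifP => // /negbFE/eqP xu.
    by rewrite xu inE e_irr in xA.
  rewrite [leqLHS]big_mkcond [leqRHS]big_mkcond /=; apply: leq_sum => x _.
  by case: ifP => // /(subsetP (OB_subB y)) ->.
have H4 : \sum_(y' in OB y) D
          <= \sum_(y' in OB y) #|out e y' :&: A|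
             + (#|OB y| * t + \sum_(y' in OB y) def y').
  rewrite -sum_nat_const -!big_split /=; apply: leq_sum => y' _.
  have := card_M y'; have := OB_le_t y'; have := cardsID (out e y') A.
  by rewrite setIC; lia.
have H5 : \sum_(z' in M y) #|out e z' :&: A| <= #|out e z| + (#|M y|).-1 * D.
  rewrite (bigD1 z) //=; apply: leq_add.
    by apply: subset_leq_card; apply: subsetIl.
  have -> : (#|M y|).-1 = #|M y :\ z| by have := cardsD1 z (M y); rewrite zM; lia.
  rewrite -sum_nat_const.
  rewrite (eq_bigl (fun i => i \in M y :\ z)); last by move=> i; rewrite in_setD1 andbC.
  apply: leq_sum => i _; apply: leq_trans (u_max i).
  by apply: subset_leq_card; apply: subsetIl.
rewrite !sum_out_inn in H4 H5.
rewrite !big_split /= in H1.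
rewrite sum_nat_const in H4.
have cM0 : 0 < #|M y| by apply/card_gt0P; exists z.
have H6 : (#|M y|).-1 * D + D = #|OB y| * D.
  by rewrite -cM; case: #|M y| cM0 => //= k _; rewrite mulSn addnC.
have H7 : #|OB y| * t <= t * t by rewrite leq_mul2r OB_le_t orbT.
move: H1 H2 H3 H4 H5 H6 H7.
move: (\sum_(w in A) #|OB y :&: _|) (\sum_(w in A) #|M y :&: _|).
move: (\sum_(w in A) t) (\sum_(w in A) p w) (\sum_(w in A) (t - p w)).
move: (\sum_(y' in OB y) def y'); lia.
Qed.

(** The out-degrees over [A] sum to about [t * n] at most, and each vertex of [Z] takes nearly
    [n / 2] of it. *)
Lemma card_high : #|Z| < 3 * t.
Proof.
apply: (high_count_lt t_ge2 card_B quad_n slack_eq e_big r_le_2t).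
have := sum_out_path u.
have : #|Z| * (D - (t * t + slack)) <= \sum_(y in A) #|out e y|.
  rewrite -sum_nat_const [leqRHS](bigID (fun z => z \in Z)) /=.
  rewrite (eq_bigl (fun i => (i \in A) && (i \in Z))); last first.
    by move=> i; rewrite !inE andbA andbb.
  apply: leq_trans (leq_addr _ _); apply: leq_sum => i.
  by rewrite !inE => /andP[_ /andP[_]]; lia.
lia.
Qed.

Lemma card_pos_sum (P : pred V) (F : V -> nat) :
  #|[set x | P x && (0 < F x)]| <= \sum_(x | P x) F x.
Proof.
rewrite -sum1_card big_mkcond [leqRHS]big_mkcond /=; apply: leq_sum => x _.
by rewrite inE; case: (P x) => //=; case: ifP.
Qed.

(* If no in-degree is large, almost every vertex of [A] is missed by some
   vertex of [B], whereas a vertex of [B] of full out-degree only misses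
   vertices of the small set [Z]. *)
Lemma indeg_large : exists w, n + t <= #|inn e w| + D.
Proof.
apply/existsP; apply: contraT; rewrite negb_exists => /forallP Hin.
pose X1 := [set w | (w != u) && (0 < t - p w)].
pose X2 := [set y | (y \in B) && (0 < def y)].
have Hsub : A \subset Z :|: X1 :|: \bigcup_(y in X2) M y.
  apply/subsetP=> w wA; rewrite !in_setU -orbA.
  have wu : w != u by apply: contraTneq wA => ->; rewrite -in_setC u_in_B.
  case: (boolP (w \in Z)) => //= wZ.
  rewrite in_set wu /=; case: posnP => //= tp.
  (* [w] already has at least [t] in-neighbours in [A]; all of [B] as well would give in-degree
     [n - D + t]. *)
  have : B :&: inn e w != B.
    apply/negP=> /eqP EB; have := Hin w; have := cardsID A (inn e w).
    have -> : inn e w :\: A = B by rewrite setDE setIC EB.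
    rewrite setIC; have := card_B; lia.
  case: (pickP [pred y | (y \in B) && (y \notin inn e w)]) => [y /andP[yB yw] _|Hno].
    apply/bigcupP; exists y; last by rewrite !inE in yw *; rewrite yw; rewrite inE in wA.
    rewrite inE yB /=; case: posnP => // dy; case/negP: wZ.
    apply: (subsetP (M_high yB dy)).
    by rewrite !inE in yw *; rewrite yw; rewrite inE in wA.
  case/eqP; apply/setIidPl; apply/subsetP=> y yB.
  by have := Hno y; rewrite /= yB => /negbFE.
have c1 : #|X1| <= \sum_(w | w != u) (t - p w) by apply: card_pos_sum.
have c2 : #|X2| <= \sum_(y in B) def y by apply: card_pos_sum.
have c3 : \sum_(y in X2) #|M y| <= #|X2| * t + \sum_(y in B) def y.
  rewrite (eq_bigr (fun y => #|OB y| + def y)); last by move=> y _; rewrite card_M.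
  rewrite big_split /=; apply: leq_add.
    by rewrite -sum_nat_const; apply: leq_sum => y _; apply: OB_le_t.
  rewrite [leqLHS]big_mkcond [leqRHS]big_mkcond /=; apply: leq_sum => x _.
  by rewrite inE; case: (x \in B) => //=; case: ifP.
have c4 := leq_trans (subset_leq_card Hsub) (leq_card_setU _ _).
have c5 := (leq_card_setU Z X1).1.
have c6 := leq_card_bigcup (fun y => y \in X2) (fun y => M y).
have c7 := card_high; have [c8 _] := D_near; have c9 := slack_quad.
have c10 : #|X2| * t <= (\sum_(y in B) def y) * t by rewrite leq_mul2r c2 orbT.
have c11 : D <= 3 * t + t.+1 * slack.
  move: c1 c3 c4 c5 c6 c7 c10; rewrite /slack.
  set a := \sum_(w | _) _; set b := \sum_(y in B) _; set c := \sum_(y in X2) _.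
  move: a b c => a b c; have := leq0n (t * a); lia.
have c12 : t.+1 * (4 * slack + 7) <= t.+1 * (t ^ 2 + 6 * t) by rewrite leq_mul2l c9 orbT.
have := leq_mul t_ge2 t_ge2; move: cubic_n; rewrite mulnn; lia.
Qed.

(** * Large maximum out-degree: many 2-cycles *)

Hypothesis recip : forall y, #|out e y| = D -> t + 2 <= #|out e y :&: inn e y|.
Hypothesis slack_lt : slack + t + 2 <= r.

(* In the graph of 2-cycles inside [B] almost all degrees are at least 2. A path
   y1, y, y2 in it forces y2 to be an out-neighbour of [M y1], hence of [Z]: so
   [Z] sends arcs to most of [B], although each z sends at most t. *)
Lemma many_recip_absurd : False.
Proof.
pose H y := OB y :&: inn e y.
pose X := [set u] :|: [set y | (y \in B) && (0 < def y)]
                  :|: [set w | (w != u) && (0 < t - p w)].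
pose S := \bigcup_(z in Z) OB z.
pose HX := \bigcup_(x in X) H x.
pose phi y := odflt u [pick x in H y :\: X].
have X_ok y : y \notin X -> [/\ y != u, y \in B -> def y = 0 & p y = t].
  rewrite !in_setU !inE !negb_or => /andP[/andP[yu Hd] Hp]; split => //.
  - by move=> yB; move: Hd; rewrite yB /=; lia.
  - by move: Hp (p_le yu); rewrite yu /=; lia.
(* Of the at least [t + 2] 2-cycles through [y], at most [p y <= t] meet [A]. *)
have H2 y : y \in B -> y \notin X -> 2 <= #|H y|.
  move=> yB /X_ok[yu /(_ yB) dy _].
  have := recip (y := y); have := out_def y; rewrite dy addn0 => -> /(_ erefl).
  have := cardsID A (out e y :&: inn e y).
  have -> : out e y :&: inn e y :\: A = H y by rewrite /H setIDAC.
  have : #|out e y :&: inn e y :&: A| <= p y.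
    by rewrite setIC; apply/subset_leq_card/setIS/subsetIr.
  have := p_le yu; lia.
have H_sym y x : y \in B -> x \in H y -> y \in H x.
  by rewrite !inE => yB /andP[/andP[_ ->] ->]; rewrite yB.
have H_B y x : x \in H y -> x \in B by rewrite !inE => /andP[/andP[]].
have path_S y y1 y2 : y \in B -> y1 \in H y -> y2 \in H y -> y1 != y2 ->
    y1 \notin X -> y2 \notin X -> y2 \in S.
  move=> yB y1H y2H y12 y1X y2X.
  have [_ /(_ (H_B _ _ y1H)) dy1 _] := X_ok _ y1X.
  have [y2u _ py2] := X_ok _ y2X.
  have : 0 < #|OB y1 :&: inn e y2|.
    apply/card_gt0P; exists y.
    by move: y1H y2H yB; rewrite !inE => /andP[/andP[_ _] ->] /andP[/andP[_ ->] _] ->.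
  have := two_paths_A (y := y1) (w := y2); rewrite eq_sym y12 => /(_ isT).
  rewrite py2 => le1 lt1.
  have : 0 < #|M y1 :&: inn e y2| by lia.
  case/card_gt0P=> z /setIP[zM zy2]; apply/bigcupP; exists z.
    exact: (subsetP (M_high (H_B _ _ y1H) dy1)).
  by have := H_B _ _ y2H; move: zy2; rewrite !inE => -> ->.
(* If [y2] is outside [X], [S] and [HX], a 2-cycle neighbour [y] of it is outside [X] and, by
   [path_S], has no other neighbour outside [X]. Having two neighbours, [y] is in [HX], and
   [phi y = y2]. *)
have Hsub : B \subset X :|: S :|: HX :|: [set phi y | y in HX].
  apply/subsetP=> y2 y2B.
  rewrite in_setU [_ \in _ :|: HX]in_setU [_ \in _ :|: S]in_setU.
  case: (boolP (y2 \in X)) => //= y2X; case: (boolP (y2 \in S)) => //= y2S.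
  case: (boolP (y2 \in HX)) => //= y2HX; apply/imsetP.
  have /card_gt0P[y yH] : 0 < #|H y2| by apply: leq_trans (H2 _ y2B y2X).
  have yB := H_B _ _ yH; have y2H := H_sym _ _ y2B yH.
  have yX : y \notin X by apply: contra y2HX => yX; apply/bigcupP; exists y.
  have only x : x \in H y -> x \notin X -> x = y2.
    move=> xH xX; apply/eqP; apply: contraNT y2S => xy2.
    exact: (path_S y x y2).
  exists y.
    have : 0 < #|H y :\ y2| by have := cardsD1 y2 (H y); rewrite y2H; have := H2 _ yB yX; lia.
    case/card_gt0P=> x /setD1P[xy2 xH]; apply/bigcupP; exists x; last exact: H_sym.
    by apply: contraNT xy2 => xX; apply/eqP; apply: only.
  rewrite /phi; case: pickP => [x /setDP[xH xX]|/(_ y2)] /=; first by rewrite (only x).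
  by rewrite inE y2X y2H.
have c1 := subset_leq_card Hsub.
have c2 := (leq_card_setU (X :|: S :|: HX) [set phi y | y in HX]).1.
have c3 := (leq_card_setU (X :|: S) HX).1.
have c4 := (leq_card_setU X S).1.
have c5 : #|[set phi y | y in HX]| <= #|HX| by apply: leq_imset_card.
have c6 : #|HX| <= #|X| * t.
  apply: leq_trans (leq_card_bigcup _ _) _; rewrite -sum_nat_const.
  apply: leq_sum => x _; apply: leq_trans (OB_le_t x).
  by apply: subset_leq_card; apply: subsetIl.
have c7 : #|S| <= #|Z| * t.
  apply: leq_trans (leq_card_bigcup _ _) _; rewrite -sum_nat_const.
  by apply: leq_sum => x _; apply: OB_le_t.
have c8 : #|X| <= slack.+1.
  have d1 : #|[set w | (w != u) && (0 < t - p w)]| <= \sum_(w | w != u) (t - p w).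
    exact: card_pos_sum.
  have d2 : #|[set y | (y \in B) && (0 < def y)]| <= \sum_(y in B) def y.
    exact: card_pos_sum.
  apply: leq_trans (leq_card_setU _ _) _; rewrite /slack.
  rewrite addnC -addnS leq_add //.
  by apply: leq_trans (leq_card_setU _ _) _; rewrite cards1 add1n.
have c9 : #|X| <= t.-1 by have := r_le_2t; lia.
have c10 : #|Z| * t <= (3 * t).-1 * t.
  by rewrite leq_mul2r; apply/orP; right; have := card_high; lia.
have c11 : #|X| * t <= t.-1 * t by rewrite leq_mul2r c9 orbT.
have c12 : (3 * t).-1 * t + t = 3 * t ^ 2 by case: (t) t_ge2 => // k _; rewrite -mulnn; lia.
have c13 : t.-1 * t + t = t ^ 2 by case: (t) t_ge2 => // k _; rewrite -mulnn; lia.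
have [_ c14] := D_near; have c15 := card_B.
have c16 : n + 2 * t <= 10 * t ^ 2 + t by lia.
(* The quadratic bound on [n] settles small [t], the cubic one large [t]. *)
case: (leqP t 20) => t20.
  have : t * t <= 20 * t by rewrite leq_mul2r t20 orbT.
  rewrite mulnn; lia.
have : 6 * t ^ 2 <= t ^ 3 by rewrite (expnS t 2) leq_mul2r; lia.
lia.
Qed.

End MaxOut.

(** * The upper bound *)

Lemma few_2paths_rev t (V : finType) (e : rel V) :
  few_2paths t e -> few_2paths t (fun x y => e y x).
Proof. by move=> He u w uw; rewrite setIC; apply: He; rewrite eq_sym. Qed.

Section UpperBound.
Variables (V : finType) (t : nat).
Hypothesis t_ge2 : 2 <= t.
Hypothesis quad_n : 17 * t ^ 2 + 60 * t + 54 <= 2 * #|V|.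
Hypothesis cubic_n : t ^ 3 + 4 * t ^ 2 + 3 * t + 4 <= #|V|.
Local Notation n := #|V|.
Local Notation c := ((n + t).+1./2).
Local Notation h := ((n - t)./2).

Let t_le_n : t <= n.
Proof. by apply: leq_trans cubic_n; lia. Qed.

(** [c + h = n] and [c - h <= t + 1], so [4 * c * h >= n ^ 2 - t.+1 ^ 2]. *)
Let g_big E : g_nt n t < E -> n ^ 2 + 4 * t * n + 8 <= 4 * E + t.+1 ^ 2.
Proof.
rewrite /g_nt => HE.
have [i ci it] : exists2 i, c = h + i & i <= t.+1 by exists (c - h); lia.
have nE : n = 2 * h + i by lia.
have it2 := leq_mul it it; move: HE nE; rewrite ci; move: (h) => k HE nE.
by rewrite -!mulnn; rewrite nE in HE *; lia.
Qed.

(** Once [D >= c], [D * (n - D) <= c * h], so in [size_slack] an excess over [g_nt] must come from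
    2-cycles, at every vertex of out-degree [D]. *)
Lemma size_le_of_max_out (e : rel V) u :
  irreflexive e -> few_2paths t e -> (forall x, #|out e x| <= #|out e u|) ->
  c <= #|out e u| -> size_rel e <= g_nt n t.
Proof.
move=> e_irr e_few u_max cD; rewrite leqNgt; apply/negP=> Hg.
have e_big := g_big Hg.
have Dn : #|out e u| <= n by apply: max_card.
have prod : #|out e u| * (n - #|out e u|) <= c * h.
  have [i iE] : exists i, #|out e u| = c + i by exists (#|out e u| - c); lia.
  have [k kE] : exists k, n - #|out e u| = k by exists (n - #|out e u|).
  rewrite kE iE.
  have hE : h = k + i by lia.
  rewrite hE mulnDl mulnDr leq_add2l mulnC leq_mul2r; apply/orP; right; lia.
have slack_recip y : #|out e y| = #|out e u| ->
    slack e t y + t + 2 <= #|out e y :&: inn e y|.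
  move=> yD; have y_max x : #|out e x| <= #|out e y| by rewrite yD.
  have := size_slack e_few y_max; rewrite yD; move: Hg; rewrite /g_nt.
  move: prod; move: (c * h) (_ * (n - _)) => a b; lia.
apply: (many_recip_absurd e_irr e_few u_max t_ge2 quad_n cubic_n e_big).
  by move=> y /slack_recip; lia.
exact: slack_recip.
Qed.

Lemma size_upper (e : rel V) :
  irreflexive e -> few_2paths t e -> size_rel e <= g_nt n t.
Proof.
move=> e_irr e_few.
have /card_gt0P[v0 _] : 0 < #|V| by apply: leq_trans cubic_n; rewrite addn4.
pose u := [arg max_(x > v0) #|out e x|].
pose v := [arg max_(x > v0) #|inn e x|].
have u_max x : #|out e x| <= #|out e u|.
  by rewrite /u; case: arg_maxnP => // y _; apply.
have v_max x : #|inn e x| <= #|inn e v|.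
  by rewrite /v; case: arg_maxnP => // y _; apply.
case: (leqP c #|out e u|) => [|uc]; first exact: size_le_of_max_out.
case: (leqP c #|inn e v|) => [vc|vc].
  rewrite size_rel_inn.
  apply: (@size_le_of_max_out (fun x y => e y x) v) => //.
  exact: few_2paths_rev.
rewrite leqNgt; apply/negP=> /g_big e_big.
(* Two degrees below [c] sum to less than [n + t]. *)
have [w] := indeg_large e_irr e_few u_max t_ge2 quad_n cubic_n e_big.
have := v_max w; lia.
Qed.
End UpperBound.

(** * Passing between arc sets and relations *)

Section Transfer.
Variables (n t : nat).

Lemma ex_Pk2_le b :
  (forall e : rel 'I_n, irreflexive e -> few_2paths t e -> size_rel e <= b) ->
  ex_Pk2 n t.+1 <= b.
Proof.
move=> Hb; apply/bigmax_leqP=> A /andP[/forallP lA]; rewrite /Pk2_free negb_exists => /forallP fA.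
pose e x y := (x, y) \in A.
suff -> : #|A| = size_rel e.
  apply: Hb => [x|u w uw]; first exact: negbTE (lA x).
  have := fA u; rewrite negb_exists => /forallP/(_ w); rewrite uw -leqNgt.
  apply: leq_trans; apply: subset_leq_card; apply/subsetP=> x; rewrite !inE /e.
  move=> /andP[ux xw]; rewrite ux xw !andbT.
  by apply/andP; split; apply/eqP=> E; move: ux xw; rewrite E ?(negbTE (lA _)).
rewrite -sum1_card (eq_bigl (fun xy => e xy.1 xy.2)); last by case.
rewrite -(pair_big_dep xpredT e (fun _ _ => 1)) /=.
apply: eq_bigr => x _; rewrite sum1_card; apply: eq_card => y.
by rewrite inE.
Qed.

Lemma leq_ex_Pk2 (V : finType) (e : rel V) :
  #|V| = n -> irreflexive e -> few_2paths t e -> size_rel e <= ex_Pk2 n t.+1.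
Proof.
move=> <- e_irr e_few.
pose f : 'I_#|V| -> V := enum_val.
have f_bij : bijective f by apply: enum_val_bij.
have f_inj := bij_inj f_bij.
pose A := [set xy | e (f xy.1) (f xy.2)].
have -> : size_rel e = #|A|.
  rewrite -sum1_card (eq_bigl (fun xy => e (f xy.1) (f xy.2))); last first.
    by move=> xy; rewrite inE.
  rewrite -(pair_big_dep xpredT (fun x y => e (f x) (f y)) (fun _ _ => 1)) /=.
  rewrite /size_rel (reindex f) /=; last exact: onW_bij.
  apply: eq_bigr => x _; rewrite -sum1_card (reindex f) /=; last exact: onW_bij.
  by apply: eq_bigl => y; rewrite inE.
apply: (leq_bigmax_cond (F := fun A : {set _} => #|A|)); apply/andP; split.
  by apply/forallP=> v; rewrite inE e_irr.
rewrite /Pk2_free negb_exists; apply/forallP=> u.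
rewrite negb_exists; apply/forallP=> w; rewrite negb_and -ltnNge ltnS -implybE.
apply/implyP=> uw; apply: leq_trans (e_few (f u) (f w) _); last by rewrite inj_eq.
rewrite -(card_imset _ f_inj); apply: subset_leq_card; apply/subsetP=> y.
by case/imsetP=> x; rewrite !inE /= => /and4P[_ _ ux xw] ->; rewrite ux xw.
Qed.
End Transfer.

(** * Counting with Boolean sums and circulant digraphs *)

Section BoolSums.
Variables (I : finType) (a b : pred I).

Lemma sum_bool_card : \sum_i (a i : nat) = #|a|.
Proof. by rewrite -sum1_card [RHS]big_mkcond; apply: eq_bigr => i _; rewrite unfold_in; case: (a i). Qed.

Lemma card_set_sum : #|[set i | a i]| = \sum_i (a i : nat).
Proof. by rewrite sum_bool_card cardsE. Qed.

Lemma sum_false : \sum_(i : I) (false : nat) = 0.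
Proof. by rewrite big1_eq. Qed.

Lemma sum_andbF : \sum_i (a i && false : nat) = 0.
Proof. by apply: big1 => i _; rewrite andbF. Qed.

Lemma sum_andbT : \sum_i (a i && true : nat) = \sum_i (a i : nat).
Proof. by apply: eq_bigr => i _; rewrite andbT. Qed.

Lemma sum_true : \sum_(i : I) (true : nat) = #|I|.
Proof. by rewrite sum1_card. Qed.

Lemma sum_andb_le : \sum_i (a i && b i : nat) <= \sum_i (a i : nat).
Proof. by apply: leq_sum => i _; case: (a i) => //; case: (b i). Qed.

Lemma sum_le_card : \sum_i (a i : nat) <= #|I|.
Proof. by rewrite sum_bool_card max_card. Qed.

Lemma sum_andb_neq j : \sum_i (a i && (j != i) : nat) + a j = \sum_i (a i : nat).
Proof.
rewrite [RHS](bigD1 j) //= addnC; congr (_ + _).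
rewrite [RHS]big_mkcond; apply: eq_bigr => i _.
by rewrite eq_sym; case: (i != j); rewrite ?andbT ?andbF.
Qed.

Lemma sum_eq_andb j : \sum_i ((i == j) && b i : nat) = b j.
Proof.
rewrite (bigD1 j) //= eqxx big1 ?addn0 // => i /negbTE ij.
by rewrite ij.
Qed.

End BoolSums.

Lemma sum_eq (I : finType) (j : I) : \sum_i (i == j : nat) = 1.
Proof. by rewrite sum_bool_card card1. Qed.

Lemma sum_neq (I : finType) (j : I) : \sum_i (i != j : nat) = #|I|.-1.
Proof. by rewrite sum_bool_card cardC1. Qed.

Section Circulant.
Variables (G : finZmodType) (S : {set G}).

Lemma sum_circ_out (p : G) : \sum_q ((q - p)%R \in S : nat) = #|S|.
Proof.
rewrite (reindex (fun x => x + p)%R) /=; last first.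
  by exists (fun x => x - p)%R => x _; rewrite ?GRing.addrK ?GRing.subrK.
by rewrite -[RHS]sum_bool_card; apply: eq_bigr => q _; rewrite GRing.addrK.
Qed.

Lemma sum_circ_in (q : G) : \sum_p ((q - p)%R \in S : nat) = #|S|.
Proof.
rewrite (reindex (fun x => q - x)%R) /=; last first.
  by exists (fun x => q - x)%R => x _; rewrite GRing.subKr.
by rewrite -[RHS]sum_bool_card; apply: eq_bigr => p _; rewrite GRing.subKr.
Qed.

Lemma sum_shift (i x : G) : \sum_p (x == (p + i)%R : nat) = 1.
Proof.
rewrite -(sum_eq (x - i)%R); apply: eq_bigr => p _.
by rewrite [p == _]eq_sym GRing.subr_eq.
Qed.
End Circulant.

Lemma exists_subset_card (T : finType) k : k <= #|T| -> exists S : {set T}, #|S| = k.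
Proof.
move=> kT; have : 0 < #|[set S : {set T} | #|S| == k]| by rewrite card_draws bin_gt0.
by case/card_gt0P=> S; rewrite inE => /eqP; exists S.
Qed.

Definition sum_boolE := (sum_false, sum_andbF, sum_andbT, sum_true, card_ord, big_ord1,
  sum_circ_out, sum_circ_in, sum_shift, sum_eq, sum_neq).

(** * Lower-bound constructions *)

Lemma card_2paths (V : finType) (e : rel V) u w :
  #|out e u :&: inn e w| = \sum_x (e u x && e x w : nat).
Proof. by rewrite -card_set_sum; apply: eq_card => x; rewrite !inE. Qed.

(* [V1 -> V2] is complete, with V1 the left summand and V2 the right one. In V1,
   ['I_t.+1] is a complete digraph and the other vertices send arcs to it minus
   [ord0]; so does one vertex of V2, the others sending [t] arcs each, evenly
   spread over [G]. The [m] extra vertices ([m <= 1]) absorb the parity of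
   [n - t]. *)
Section ConstructionA.
Variables (t m c : nat) (G : finZmodType).
Hypothesis card_G : #|G| = c.

Definition vertA : finType := ('I_t.+1 + (G + 'I_m) + ('I_1 + G))%type.

Lemma card_vertA : #|vertA| = t + 2 + m + 2 * c.
Proof. by rewrite /vertA !card_sum !card_ord !card_G; lia. Qed.

Variable S : {set G}.
Hypothesis card_S : #|S| = t.

Definition arcA (u w : vertA) : bool :=
  match u, w with
  | inl (inl k), inl (inl k') => k' != k
  | inl (inr _), inl (inl k) => k != ord0
  | inl _, inl (inr _) => false
  | inl _, inr _ => true
  | inr (inl _), inl (inl k) => k != ord0
  | inr (inr p), inl (inr (inl q)) => (q - p)%R \in S
  | inr _, _ => false
  end.

Lemma arcA_irr : irreflexive arcA.
Proof. by case=> [[k|[q|x]]|[j|p]] //=; rewrite eqxx. Qed.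

(** Every vertex sends exactly [t] arcs into V1, and there are none inside V2; this settles paths
    from or to V2. From V1 into ['I_t.+1], the special vertex of V2 adds a midpoint only when the
    target is not [ord0]. *)
Lemma arcA_few : few_2paths t arcA.
Proof.
have sum_neq2 (k k' : 'I_t.+1) :
    \sum_(i < t.+1) ((i != k) && (k' != i) : nat) + (k' != k) = t.
  by rewrite sum_andb_neq !sum_boolE.
move=> u w; rewrite card_2paths !big_sumType /=.
case: u => [[k|[q|x]]|[j|p]]; case: w => [[k'|[q'|x']]|[j'|p']] //= uw; rewrite ?sum_boolE ?card_S; try lia.
- have kk : k' != k by apply: contraNneq uw => ->.
  by rewrite -[leqRHS](sum_neq2 k k') kk !addn0 leq_add2l; case: (_ != _).
- by rewrite -[leqRHS](sum_neq2 ord0 k') !addn0 leq_add2l.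
- by rewrite -[leqRHS](sum_neq2 ord0 k') !addn0 leq_add2l.
- by rewrite -[leqRHS](sum_neq2 ord0 k') !addn0 leq_addr.
rewrite !addn0 add0n.
by apply: leq_trans (sum_andb_le _ _) _; rewrite sum_boolE card_S.
Qed.

Lemma size_arcA : size_rel arcA =
  (t + 1 + c + m) * (1 + c) + t * (t + 1) + t * (c + m) + t + c * t.
Proof.
rewrite /size_rel; under eq_bigr do rewrite card_set_sum !big_sumType.
rewrite !big_sumType /=.
have E1 : \sum_(i < t.+1) \sum_(j < t.+1) (j != i : nat) = t.+1 * t.
  by under eq_bigr do rewrite sum_neq card_ord; rewrite sum_nat_const card_ord.
have E2 : \sum_p \sum_q ((q - p)%R \in S : nat) = c * t.
  by under eq_bigr do rewrite sum_circ_out card_S; rewrite sum_nat_const card_G.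
rewrite !big_split /= E1 E2 !big1_eq !sum_neq !sum_nat_const !card_ord !card_G; lia.
Qed.
End ConstructionA.

(* As in construction A, but the vertices of V1 have out-degree one less inside
   V1 and those of V2 have in-degree one inside V2, thanks to perfect matchings by
   2-cycles ([x] with [x + i], and [true] with [false]). Such a matching creates no
   2-path between distinct vertices, which is what gains one arc; it requires
   [#|G|] even. The vertex of ['I_eps], present for one parity of [n - t], has
   taken over the arc from [true] to [ord0]. *)
Section ConstructionB.
Variables (t c : nat) (eps : bool) (G : finZmodType).
Hypothesis card_G : #|G| = c.

Definition vertB : finType := ('I_t.+2 + G + (bool + G + 'I_eps))%type.

Lemma card_vertB : #|vertB| = t + 4 + eps + 2 * c.
Proof. by rewrite /vertB !card_sum !card_ord !card_bool !card_G; lia. Qed.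

Variables (S : {set G}) (i : G).
Hypothesis card_S : #|S| = t.+2.
Hypothesis i_neq0 : i != 0%R.
Hypothesis i_order2 : (i + i = 0)%R.

Definition arcB (u w : vertB) : bool :=
  match u, w with
  | inl (inl k), inl (inl k') => k' != k
  | inl (inl k), inl (inr q) => false
  | inl (inr q), inl (inl k) => 2 <= k
  | inl (inr q), inl (inr q') => q' == (q + i)%R
  | inl _, inr _ => true
  | inr (inl (inl b)), inl (inl k) => ~~ [&& b, eps & k == ord0]
  | inr (inl (inl b)), inr (inl (inl b')) => b' != b
  | inr (inl (inl b)), inr (inr _) => ~~ b
  | inr (inl (inr p)), inl (inr q) => (q - p)%R \in S
  | inr (inl (inr p)), inr (inl (inr p')) => p' == (p + i)%R
  | inr (inr _), inl (inl k) => k == ord0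
  | inr _, _ => false
  end.

Lemma shift_neq (q : G) : (q == q + i)%R = false.
Proof. by rewrite eq_sym -GRing.subr_eq0 GRing.addrC GRing.addKr (negbTE i_neq0). Qed.

Lemma arcB_irr : irreflexive arcB.
Proof. by case=> [[k|q]|[[b|p]|x]] //=; rewrite ?eqxx ?shift_neq. Qed.

Let sum_ge2 : \sum_(k < t.+2) (2 <= k : nat) = t.
Proof. by rewrite !big_ord_recl /= sum_true card_ord. Qed.

(** From V1 to V2 there are [t + 1] midpoints in V1 and one in V2. From V1 to ['I_t.+2] there are at
    most [t] in V1, and exactly two in V2 by [into_k]. *)
Lemma arcB_few : few_2paths t.+2 arcB.
Proof.
have sum_neq2 (k k' : 'I_t.+2) :
    \sum_(l < t.+2) ((l != k) && (k' != l) : nat) + (k' != k) = t.+1.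
  by rewrite sum_andb_neq !sum_boolE.
have sum_ge2_neq (k : 'I_t.+2) :
    \sum_(l < t.+2) ((2 <= l) && (k != l) : nat) + (2 <= k) = t.
  by rewrite sum_andb_neq.
have shift2 (q q' : G) : \sum_p ((p == (q + i)%R) && (q' == (p + i)%R) : nat) = (q' == q).
  by rewrite sum_eq_andb -GRing.addrA i_order2 GRing.addr0.
have into_k (k : 'I_t.+2) :
    ~~ (eps && (k == ord0)) + \sum_(j < eps) (k == ord0 : nat) = 1.
  by rewrite sum_nat_const card_ord; case: eps; case: (k == ord0).
have sum_andb_le2 (I : finType) (a b : pred I) :
    \sum_j (a j && b j : nat) <= \sum_j (b j : nat).
  by under eq_bigr do rewrite andbC; apply: sum_andb_le.
have sum_neqC (k : 'I_t.+2) : \sum_(l < t.+2) (k != l : nat) = t.+1.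
  by under eq_bigr do rewrite eq_sym; rewrite !sum_boolE.
move=> u w; rewrite card_2paths !big_sumType /= !big_bool /=.
case: u => [[k|q]|[[b|p]|x]]; case: w => [[k'|q']|[[b'|p']|x']] //= uw;
  rewrite ?sum_boolE ?card_S ?shift2 ?sum_eq_andb ?sum_ge2 ?addn0 ?add0n //=; try lia.
- have kk : k' != k by apply: contraNneq uw => ->.
  have := into_k k'; have := sum_neq2 k k'; rewrite kk.
  by move: (\sum_(l < t.+2) _) (\sum_(l < eps) _); case: (k' == ord0); lia.
- have := into_k k'; have := sum_ge2_neq k'.
  by move: (\sum_(l < t.+2) _) (\sum_(l < eps) _); case: (k' == ord0); lia.
- by have /negbTE-> : q' != q by apply: contraNneq uw => ->.
- have := into_k k'.
  have := sum_andb_le2 _ (fun l => ~~ [&& b, eps & l == ord0]) (fun l => k' != l).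
  rewrite sum_neqC; case: b {uw} => /=; rewrite ?sum_false.
    by move: (\sum_(l < t.+2) _); lia.
  by move: (\sum_(l < t.+2) _) (\sum_(l < eps) _); case: (k' == ord0); lia.
- have := sum_le_card (fun l : 'I_t.+2 => ~~ [&& b, eps & l == ord0]).
  by rewrite card_ord; move: uw; case: b; case: b' => //= _; move: (\sum_(l < t.+2) _); lia.
- have := sum_le_card (fun l : 'I_t.+2 => ~~ [&& b, eps & l == ord0]).
  by rewrite card_ord; case: b {uw} => /=; move: (\sum_(l < t.+2) _); lia.
- case: b {uw} => /=; last first.
    have := sum_le_card (fun l : 'I_t.+2 => true).
    by rewrite card_ord; move: (\sum_(l < t.+2) _); lia.
  have -> : eps = true by case: eps x' => // -[].
  by rewrite /= sum_neq card_ord; lia.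
- by apply: leq_trans (sum_andb_le _ _) _; rewrite sum_boolE card_S.
- have := sum_andb_le2 _ (fun j => (j - p)%R \in S) (fun j => q' == (j + i)%R).
  rewrite sum_shift; move: (\sum_j _) => X X1.
  by case: (_ \in S); lia.
have /negbTE-> : p' != p by apply: contraNneq uw => ->.
by rewrite addn0.
Qed.

Lemma size_arcB : size_rel arcB =
  (t + 2 + c) * (c + 2 + eps) + (t + 2) * (t + 1) + c * (t + 1)
  + 2 * (t + 2) + 2 + eps + c + c * (t + 2).
Proof.
rewrite /size_rel; under eq_bigr do rewrite card_set_sum !big_sumType.
rewrite !big_sumType /= !big_bool /=.
have E1 : \sum_(j < t.+2) \sum_(k < t.+2) (k != j : nat) = t.+2 * t.+1.
  by under eq_bigr do rewrite sum_neq card_ord; rewrite sum_nat_const card_ord.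
have E2 : \sum_p \sum_q ((q - p)%R \in S : nat) = c * t.+2.
  by under eq_bigr do rewrite sum_circ_out card_S; rewrite sum_nat_const card_G.
have E3 : \sum_p \sum_q (q == (p + i)%R : nat) = c.
  by under eq_bigr do rewrite sum_eq; rewrite sum_nat_const card_G muln1.
have E4 : \sum_(k < t.+2) (~~ (eps && (k == ord0)) : nat) + eps = t.+2.
  case: eps => /=; last by rewrite sum_true card_ord addn0.
  by rewrite sum_neq card_ord addn1.
rewrite !big_split /= E1 E2 E3 !big1_eq sum_ge2 !sum_eq !sum_nat_const !card_ord !card_G.
move: (\sum_(k < t.+2) _) (nat_of_bool eps) E4 => X m E4; lia.
Qed.
End ConstructionB.

(** * Lower bounds and conclusion *)

Lemma leq_ex_Pk2_pred n t : 2 <= t -> t ^ 3 + 4 * t ^ 2 + 3 * t + 4 <= n ->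
  (g_nt n t).-1 <= ex_Pk2 n t.+1.
Proof.
move=> t_ge2 n_big.
have [c [m [nE m1 tc]]] : exists c m, [/\ t + 2 + m + 2 * c.+1 = n, m <= 1 & t <= c].
  exists ((n - t)./2 - 2), (odd (n - t)); split; try lia.
pose G : finZmodType := 'I_c.+1.
have cG : #|G| = c.+1 by rewrite card_ord.
have [S cS] : exists S : {set G}, #|S| = t by apply: exists_subset_card; rewrite cG; lia.
have cV := etrans (card_vertA t m cG) nE.
have := @leq_ex_Pk2 n t (vertA t m G) (arcA S) cV (@arcA_irr t m G S) (arcA_few cG cS).
rewrite (size_arcA m cG cS).
apply: leq_trans; rewrite /g_nt.
have -> : (n + t).+1./2 = t + c + 2 + m by lia.
have -> : (n - t)./2 = c + 2 by lia.
rewrite -nE; lia.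
Qed.

Lemma leq_ex_Pk2_odd n t : 2 <= t -> t ^ 3 + 4 * t ^ 2 + 3 * t + 4 <= n ->
  odd (n - t)./2 -> g_nt n t <= ex_Pk2 n t.+1.
Proof.
(* Construction B is indexed by [t - 2]. *)
case: t => [|[|t]] // _ n_big h_odd.
have [k [eps [nE cm]]] : exists k (eps : bool), t + 4 + eps + 2 * (2 * k.+1) = n /\ t.+2 <= 2 * k.+1.
  exists ((n - t.+2)./2./2.-1), (odd (n - t.+2)); split; lia.
pose G : finZmodType := 'I_(2 * k).+2.
have cG : #|G| = 2 * k.+1 by rewrite card_ord; lia.
have [S cS] : exists S : {set G}, #|S| = t.+2 by apply: exists_subset_card; rewrite cG; lia.
(* [G] is cyclic of order [(n - t)./2 - 1] for the original [t], which is even; [i] is its element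
   of order 2. *)
pose i : G := inord k.+1.
have iE : i = k.+1 :> nat by rewrite inordK //; lia.
have i0 : i != 0%R by rewrite -val_eqE /= iE.
have i2 : (i + i = 0)%R.
  by apply: val_inj; rewrite /= iE (_ : k.+1 + k.+1 = (2 * k).+2) ?modnn //; lia.
have cV := etrans (card_vertB t eps cG) nE.
have := @leq_ex_Pk2 n t.+2 (vertB t eps G) (arcB S i) cV (@arcB_irr t eps G S i i0)
  (arcB_few cG cS i0 i2).
rewrite (size_arcB eps cG cS i0).
apply: leq_trans; rewrite /g_nt {cV}.
have -> : (n + t.+2).+1./2 = t + 2 * k.+1 + 3 + eps by case: eps nE => /= nE; lia.
have -> : (n - t.+2)./2 = (2 * k.+1).+1 by case: eps nE => /= nE; lia.
by rewrite -nE; move: (nat_of_bool eps) => m; lia.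
Qed.

Theorem theorem1p1 (n t : nat) :
  2 <= t ->
  t ^ 3 + 4 * t ^ 2 + 3 * t + 4 <= n ->
  17 * t ^ 2 + 60 * t + 54 <= 2 * n ->
  (odd ((n - t)./2) -> ex_Pk2 n t.+1 = g_nt n t) /\
  (~~ odd ((n - t)./2) ->
     ex_Pk2 n t.+1 = (g_nt n t).-1 \/ ex_Pk2 n t.+1 = g_nt n t).
Proof.
move=> t_ge2 cubic quad.
have upper : ex_Pk2 n t.+1 <= g_nt n t.
  apply: ex_Pk2_le => e e_irr e_few.
  by have := @size_upper 'I_n t; rewrite card_ord; apply.
have lower := leq_ex_Pk2_pred t_ge2 cubic.
split=> h_odd; last by lia.
by apply/eqP; rewrite eqn_leq upper leq_ex_Pk2_odd.
Qed.
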